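(* Let $R$ be a ring and let $\zeta:Q_0\to Q_1$ be an $R$-homomorphism between injective right $R$-modules with $T=\operatorname{Ker}\zeta$. Assume that $T$ is a cosilting module in $\operatorname{Mod} R$, and let $I$ be the torsion part of $R$ (i.e. the torsion submodule of the right module $R_R$) with respect to the torsion pair $(\operatorname{Ker}\operatorname{Hom}_R(-,T),\operatorname{Cogen}T)$ in $\operatorname{Mod} R$. If one of the following conditions holds: (1) $R$ is commutative; (2) $R/I$ is finitely generated as a module over $\operatorname{End}_R(R/I)$; then $T$ is a cotilting module in $\operatorname{Mod}(R/J)$, where $J=\operatorname{ann}_R(R/I)=\{r\in R\mid (R/I)r=0\}$.
   Context: $R$ is a ring with unit and $\operatorname{Mod} R$ is the category of right $R$-modules. For an $R$-homomorphism $\zeta:Q_0\to Q_1$, $\mathcal{B}_\zeta=\{X\in\operatorname{Mod} R \mid \operatorname{Hom}_R(X,\zeta):\operatorname{Hom}_R(X,Q_0)\to\operatorname{Hom}_R(X,Q_1)\text{ is surjective}\}$. $\operatorname{Cogen} T$ is the class of all right $R$-modules that embed into a direct product of copies of $T$. A module $T$ is cosilting (with respect to $\zeta$) if there is an exact sequence $0\to T\to Q_0\xrightarrow{\zeta}Q_1$ with $Q_0,Q_1$ injective and $\operatorname{Cogen} T=\mathcal{B}_\zeta$. For a cosilting module $T$, the pair $(\operatorname{Ker}\operatorname{Hom}_R(-,T),\operatorname{Cogen}T)$ is a torsion pair in $\operatorname{Mod} R$, where $\operatorname{Ker}\operatorname{Hom}_R(-,T)=\{X\mid \operatorname{Hom}_R(X,T)=0\}$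 is the torsion class. For an abelian category $\mathcal{A}$, $\operatorname{Ext}^1_{\mathcal{A}}$ is the Yoneda extension group. If products of copies of $T$ exist in $\mathcal{A}$, $\operatorname{Cogen}_{\mathcal{A}}T$ is the class of objects of $\mathcal{A}$ that embed into a product of copies of $T$ in $\mathcal{A}$. $T$ is cotilting in $\mathcal{A}$ if $\operatorname{Cogen}_{\mathcal{A}}T=\operatorname{Ker}\operatorname{Ext}^1_{\mathcal{A}}(-,T)$; this is applied with $\mathcal{A}=\operatorname{Mod}(R/J)$. *)

(* Defs.v *)
From HB Require Import structures.
From mathcomp Require Import all_boot all_algebra.
From mathcomp Require Import boolp functions.

Set Implicit Arguments.
Unset Strict Implicit.
Unset Printing Implicit Defensive.

Import GRing.Theory.
Local Open Scope ring_scope.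
Local Open Scope quotient_scope.

(* MathComp modules are left modules, so a right module over R is an
   [lmodType R^c]: there [r *: x] is x r, and R as a right module over itself
   is [(R^c)^o].  Rings are [pzRingType]s because R/J is the zero ring when
   T = 0.  The notions that do not depend on the side are stated for
   [lmodType S] and are used with S := R^c and S := (R/J)^c. *)

Section Submodules.
Variables (S : pzRingType) (M : lmodType S).

Definition submod (N : submodClosed M) : Type := {x : M | x \in N}.

Section OneSubmodule.
Variable N : submodClosed M.

Lemma submodClosedP : GRing.subsemimod_closed N.
Proof.
split; first by split; [exact: rpred0|exact: rpredD].
by move=> a x; exact: rpredZ.
Qed.

HB.instance Definition _ := SubChoice.on (submod N).
HB.instance Definition _ :=
  GRing.SubChoice_isSubLmodule.Build S M (mem N) (submod N) submodClosedP.

(* [Quotient.quot] asks for stability under opposites, which the class of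
   [submodClosed] does not record. *)
Definition zsubmod : {pred M} := [pred x | x \in N].

Lemma zsubmod_zmod_closed : zmod_closed zsubmod.
Proof.
split=> [|x y]; rewrite !inE; first exact: rpred0.
by move=> Nx Ny; rewrite rpredD // -scaleN1r rpredZ.
Qed.

HB.instance Definition _ := GRing.isZmodClosed.Build M zsubmod
  zsubmod_zmod_closed.

Definition quotmod : Type := Quotient.quot zsubmod.

HB.instance Definition _ := GRing.Zmodule.on quotmod.

Definition quotmod_proj (x : M) : quotmod := \pi_(Quotient.quot zsubmod) x.

Definition quotmod_scale (a : S) (q : quotmod) : quotmod :=
  quotmod_proj (a *: repr (q : Quotient.quot zsubmod)).

Lemma quotmod_projP x y : quotmod_proj x = quotmod_proj y <-> x - y \in N.
Proof.
by rewrite /quotmod_proj; split=> [/eqP|h]; last apply/eqP;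
  rewrite -Quotient.idealrBE.
Qed.

Lemma quotmod_proj_surj (q : quotmod) : exists x, quotmod_proj x = q.
Proof. by exists (repr (q : Quotient.quot zsubmod)); exact: reprK. Qed.

Lemma quotmod_projD x y :
  quotmod_proj (x + y) = quotmod_proj x + quotmod_proj y.
Proof. exact: (raddfD (\pi_(Quotient.quot zsubmod))). Qed.

Lemma quotmod_projZ a x :
  quotmod_proj (a *: x) = quotmod_scale a (quotmod_proj x).
Proof.
apply/quotmod_projP; rewrite -scalerBr rpredZ //; apply/quotmod_projP.
by rewrite /quotmod_proj reprK.
Qed.

Lemma quotmod_scaleA a b q :
  quotmod_scale a (quotmod_scale b q) = quotmod_scale (a * b) q.
Proof.
by have [x <-] := quotmod_proj_surj q; rewrite -!quotmod_projZ scalerA.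
Qed.

Lemma quotmod_scale1 : left_id 1 quotmod_scale.
Proof.
by move=> q; have [x <-] := quotmod_proj_surj q; rewrite -quotmod_projZ scale1r.
Qed.

Lemma quotmod_scaleDr : right_distributive quotmod_scale +%R.
Proof.
move=> a q1 q2; have [x <-] := quotmod_proj_surj q1.
have [y <-] := quotmod_proj_surj q2.
by rewrite -quotmod_projD -!quotmod_projZ -quotmod_projD scalerDr.
Qed.

Lemma quotmod_scaleDl q : {morph quotmod_scale^~ q : a b / a + b}.
Proof.
move=> a b /=; have [x <-] := quotmod_proj_surj q.
by rewrite -!quotmod_projZ -quotmod_projD scalerDl.
Qed.

HB.instance Definition _ := GRing.Zmodule_isLmodule.Build S quotmod
  quotmod_scaleA quotmod_scale1 quotmod_scaleDr quotmod_scaleDl.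

End OneSubmodule.
End Submodules.

Section Kernel.
Variables (S : pzRingType) (U V : lmodType S) (f : {linear U -> V}).

Definition ker : {pred U} := [pred x | f x == 0].

Lemma ker_submod_closed : GRing.subsemimod_closed ker.
Proof.
split; first split=> [|x y]; rewrite ?inE ?raddf0 //.
  by move=> /eqP fx /eqP fy; rewrite raddfD /= fx fy addr0.
by move=> a x; rewrite !inE linearZ /= => /eqP ->; rewrite scaler0.
Qed.

HB.instance Definition _ := GRing.isSubmodClosed.Build S U ker
  ker_submod_closed.

End Kernel.

Definition kermod (S : pzRingType) (U V : lmodType S) (f : {linear U -> V}) :
  lmodType S := submod (ker f).

(* Module classes: Cogen T, B_zeta and Ker Hom(-, T). *)

Definition Cogen (S : pzRingType) (T X : lmodType S) : Prop :=
  exists (I : Type) (f : {linear X -> (I -> T)}), injective f.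

Definition B_ (S : pzRingType) (Q0 Q1 : lmodType S) (zeta : {linear Q0 -> Q1})
    (X : lmodType S) : Prop :=
  forall g : {linear X -> Q1}, exists f : {linear X -> Q0}, zeta \o f =1 g.

Definition KerHom (S : pzRingType) (T X : lmodType S) : Prop :=
  forall (f : {linear X -> T}) (x : X), f x = 0.

Definition injective_module (S : pzRingType) (Q : lmodType S) : Prop :=
  forall (A B : lmodType S) (i : {linear A -> B}) (f : {linear A -> Q}),
    injective i -> exists g : {linear B -> Q}, g \o i =1 f.

Definition cosilting_wrt (S : pzRingType) (T Q0 Q1 : lmodType S)
    (zeta : {linear Q0 -> Q1}) : Prop :=
  [/\ injective_module Q0, injective_module Q1,
      exists2 i : {linear T -> Q0}, injective i &
        (forall y : Q0, zeta y = 0 <-> exists x, i x = y)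
    & forall X : lmodType S, Cogen T X <-> B_ zeta X].

Definition cosilting (S : pzRingType) (T : lmodType S) : Prop :=
  exists (Q0 Q1 : lmodType S) (zeta : {linear Q0 -> Q1}), cosilting_wrt T zeta.

Section TorsionPart.
Variables (S : pzRingType) (C : lmodType S -> Prop) (M : lmodType S).

(* The torsion part of M is the sum of the submodules of M that belong to the
   torsion class C, i.e. the least submodule containing all of them. *)
Definition torsion_part : {pred M} := fun x =>
  `[< forall L : submodClosed M,
        (forall N : submodClosed M, C (submod N) -> {subset N <= L}) ->
        x \in L >].

Lemma torsion_part_submod_closed : GRing.subsemimod_closed torsion_part.
Proof.
split; first split=> [|x y /asboolP hx /asboolP hy].
- by apply/asboolP=> L _; exact: rpred0.
- by apply/asboolP=> L hL; rewrite rpredD ?hx ?hy.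
- by move=> a x /asboolP hx; apply/asboolP=> L hL; rewrite rpredZ ?hx.
Qed.

HB.instance Definition _ := GRing.isSubmodClosed.Build S M torsion_part
  torsion_part_submod_closed.

End TorsionPart.
Arguments torsion_part {S} C M.

(* M is finitely generated over its endomorphism ring, which acts on M by
   evaluation. *)
Definition fin_gen_over_End (S : pzRingType) (M : lmodType S) : Prop :=
  exists (n : nat) (g : 'I_n -> M), forall x : M,
    exists f : 'I_n -> {linear M -> M}, x = \sum_(i < n) f i (g i).

(* Yoneda's Ext^1(X, T): classes of extensions 0 -> T -> E -> X -> 0, the zero
   class being that of the split extension.  A morphism of extensions that is
   the identity on both ends is automatically an isomorphism. *)
Record extension (S : pzRingType) (X T : lmodType S) := Extension {
  ext_mid : lmodType S;
  ext_in : {linear T -> ext_mid};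
  ext_out : {linear ext_mid -> X};
  ext_in_inj : injective ext_in;
  ext_exact : forall e, ext_out e = 0 <-> exists t, ext_in t = e;
  ext_out_surj : forall x, exists e, ext_out e = x
}.

Definition ext_equiv (S : pzRingType) (X T : lmodType S)
    (E F : extension X T) : Prop :=
  exists phi : {linear ext_mid E -> ext_mid F},
    phi \o ext_in E =1 ext_in F /\ ext_out F \o phi =1 ext_out E.

Section SplitExtension.
Variables (S : pzRingType) (X T : lmodType S).

Definition split_in (t : T) : T * X := (t, 0).

Lemma split_in_linear : linear split_in.
Proof. by move=> a t u; congr (_, _); rewrite /= scaler0 addr0. Qed.

HB.instance Definition _ := GRing.isLinear.Build S T (T * X)%type *:%R split_in
  split_in_linear.

Lemma split_in_inj : injective split_in.
Proof. by move=> t u []. Qed.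

Lemma split_exact (e : T * X) : e.2 = 0 <-> exists t, split_in t = e.
Proof.
by case: e => t x; split=> /= [->|[u [_ <-]]] //; exists t.
Qed.

Lemma split_out_surj (x : X) : exists e : T * X, e.2 = x.
Proof. by exists (0, x). Qed.

Definition split_extension : extension X T :=
  @Extension S X T (T * X)%type split_in snd
    split_in_inj split_exact split_out_surj.

End SplitExtension.

Definition Ext1_zero (S : pzRingType) (X T : lmodType S) : Prop :=
  forall E : extension X T, ext_equiv E (split_extension X T).

Definition cotilting (S : pzRingType) (T : lmodType S) : Prop :=
  forall X : lmodType S, Cogen T X <-> Ext1_zero X T.

(* Annihilators and quotients by two-sided ideals.  The ideals of
   [ring_quotient] are proper and their quotients are commutative. *)

Record ideal (R : pzRingType) := Ideal {
  ideal_pred :> {pred R};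
  ideal_zmod_closed : zmod_closed ideal_pred;
  idealMl : forall a x, x \in ideal_pred -> a * x \in ideal_pred;
  idealMr : forall a x, x \in ideal_pred -> x * a \in ideal_pred
}.

Section Annihilator.
Variables (R : pzRingType) (M : lmodType R^c).

Definition ann_pred : {pred R} := fun r =>
  `[< forall x : M, (r : R^c) *: x = 0 >].

Lemma ann_zmod_closed : zmod_closed ann_pred.
Proof.
split=> [|r s /asboolP hr /asboolP hs]; apply/asboolP=> x.
  exact: (scale0r x).
by rewrite (scalerBl (r : R^c) s x) hr hs subr0.
Qed.

Lemma ann_mull a r : r \in ann_pred -> a * r \in ann_pred.
Proof.
move=> /asboolP hr; apply/asboolP=> x.
by rewrite -(scalerA (r : R^c) (a : R^c) x) hr.
Qed.

Lemma ann_mulr a r : r \in ann_pred -> r * a \in ann_pred.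
Proof.
move=> /asboolP hr; apply/asboolP=> x.
by rewrite -(scalerA (a : R^c) (r : R^c) x) hr scaler0.
Qed.

Definition ann : ideal R := Ideal ann_zmod_closed ann_mull ann_mulr.

End Annihilator.

Section QuotientRing.
Variables (R : pzRingType) (J : ideal R).

HB.instance Definition _ := GRing.isZmodClosed.Build R (ideal_pred J)
  (ideal_zmod_closed J).

Definition quotring : Type := Quotient.quot (ideal_pred J).

HB.instance Definition _ := GRing.Zmodule.on quotring.

Definition quotring_proj (r : R) : quotring :=
  \pi_(Quotient.quot (ideal_pred J)) r.

Definition quotring_repr (q : quotring) : R :=
  repr (q : Quotient.quot (ideal_pred J)).

Definition quotring_one : quotring := quotring_proj 1.

Definition quotring_mul (p q : quotring) : quotring :=
  quotring_proj (quotring_repr p * quotring_repr q).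

Lemma quotring_projP r s : quotring_proj r = quotring_proj s <-> r - s \in J.
Proof.
by rewrite /quotring_proj; split=> [/eqP|h]; last apply/eqP;
  rewrite -Quotient.idealrBE.
Qed.

Lemma quotring_reprK q : quotring_proj (quotring_repr q) = q.
Proof. exact: reprK. Qed.

Lemma quotring_projD r s :
  quotring_proj (r + s) = quotring_proj r + quotring_proj s.
Proof. exact: (raddfD (\pi_(Quotient.quot (ideal_pred J)))). Qed.

Lemma quotring_projM r s :
  quotring_proj (r * s) = quotring_mul (quotring_proj r) (quotring_proj s).
Proof.
apply/quotring_projP.
set r' := quotring_repr _; set s' := quotring_repr _.
have -> : r * s - r' * s' = (r - r') * s + r' * (s - s').
  by rewrite mulrBl mulrBr addrA subrK.
have rr' : r - r' \in J by apply/quotring_projP; rewrite quotring_reprK.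
have ss' : s - s' \in J by apply/quotring_projP; rewrite quotring_reprK.
by apply: rpredD; [exact: idealMr|exact: idealMl].
Qed.

Lemma quotring_mulA : associative quotring_mul.
Proof.
move=> p q r; rewrite -(quotring_reprK p) -(quotring_reprK q).
by rewrite -(quotring_reprK r) -!quotring_projM mulrA.
Qed.

Lemma quotring_mul1l : left_id quotring_one quotring_mul.
Proof. by move=> p; rewrite -(quotring_reprK p) -quotring_projM mul1r. Qed.

Lemma quotring_mul1r : right_id quotring_one quotring_mul.
Proof. by move=> p; rewrite -(quotring_reprK p) -quotring_projM mulr1. Qed.

Lemma quotring_mulDl : left_distributive quotring_mul +%R.
Proof.
move=> p q r; rewrite -(quotring_reprK p) -(quotring_reprK q).
by rewrite -(quotring_reprK r) -quotring_projD -!quotring_projM -quotring_projD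
  mulrDl.
Qed.

Lemma quotring_mulDr : right_distributive quotring_mul +%R.
Proof.
move=> p q r; rewrite -(quotring_reprK p) -(quotring_reprK q).
by rewrite -(quotring_reprK r) -quotring_projD -!quotring_projM -quotring_projD
  mulrDr.
Qed.

HB.instance Definition _ := GRing.Zmodule_isPzRing.Build quotring
  quotring_mulA quotring_mul1l quotring_mul1r quotring_mulDl quotring_mulDr.

End QuotientRing.

Definition annihilates (R : pzRingType) (J : ideal R) (M : lmodType R^c) : Prop :=
  forall r, r \in J -> forall x : M, (r : R^c) *: x = 0.

Section OverQuotientRing.
Variables (R : pzRingType) (J : ideal R) (M : lmodType R^c).
Hypothesis MJ0 : annihilates J M.

(* M with its right R/J-module structure, x (r + J) = x r; the phantom
   argument is the proof that the action is well defined. *)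
Definition over_quotring (_ : annihilates J M) : Type := M.

HB.instance Definition _ := GRing.Zmodule.on (over_quotring MJ0).

Definition over_scale (q : (quotring J)^c) (x : over_quotring MJ0) :
  over_quotring MJ0 := (quotring_repr (q : quotring J) : R^c) *: (x : M).

Lemma over_scaleE (r : R) (x : over_quotring MJ0) :
  over_scale (quotring_proj J r) x = (r : R^c) *: (x : M).
Proof.
apply/eqP; rewrite -subr_eq0; apply/eqP.
rewrite /over_scale -[LHS](scalerBl (_ : R^c) _ (x : M)); apply: MJ0.
by apply/quotring_projP; rewrite quotring_reprK.
Qed.

Lemma over_scaleA p q x :
  over_scale p (over_scale q x) = over_scale (p * q) x.
Proof.
rewrite -(quotring_reprK p) -(quotring_reprK q).
set a := quotring_repr p; set b := quotring_repr q.
have -> : (quotring_proj J a : (quotring J)^c) * quotring_proj J b =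
    quotring_proj J (b * a) by rewrite quotring_projM.
by rewrite !over_scaleE scalerA.
Qed.

Lemma over_scale1 : left_id 1 over_scale.
Proof.
by move=> x; rewrite (over_scaleE 1 x) -[RHS](scale1r (x : M)).
Qed.

Lemma over_scaleDr : right_distributive over_scale +%R.
Proof. by move=> q x y; exact: scalerDr. Qed.

Lemma over_scaleDl x : {morph over_scale^~ x : p q / p + q}.
Proof.
move=> p q /=; rewrite -(quotring_reprK p) -(quotring_reprK q).
set a := quotring_repr p; set b := quotring_repr q.
have -> : (quotring_proj J a : (quotring J)^c) + quotring_proj J b =
    quotring_proj J (a + b) by rewrite quotring_projD.
by rewrite !over_scaleE -[RHS]scalerDl.
Qed.

HB.instance Definition _ := GRing.Zmodule_isLmodule.Build (quotring J)^c
  (over_quotring MJ0) over_scaleA over_scale1 over_scaleDr over_scaleDl.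

End OverQuotientRing.

(* Main.v *)
From HB Require Import structures.
Require Import Defs.
From mathcomp Require Import all_boot all_algebra.
From mathcomp Require Import boolp functions.

Set Implicit Arguments.
Unset Strict Implicit.
Unset Printing Implicit Defensive.

Import GRing.Theory.
Local Open Scope ring_scope.

(** Let T be cosilting with respect to zeta : Q0 -> Q1, and write P for the right
    annihilator of T in R.  A homomorphism from the right
    module R to T is left multiplication by an element of T, so P is the
    intersection of the kernels of all of them; hence R/P lies in Cogen T.

    Everything rests on one half of the long exact sequence
    ([B_extends]): if X is in B_zeta, maps to T = Ker zeta extend along every
    monomorphism with cokernel X.  Applied to P in R, whose cokernel R/P is in
    Cogen T = B_zeta, it makes every map P -> T the restriction of a map
    R -> T; such a map vanishes on P, so Hom(P, T) = 0.  Thus P is torsion, and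
    it is exactly the torsion part I of R ([torsion_part_regular]).  In
    particular I is a two-sided ideal and J = ann (R/I) = I = P, so the
    corollary amounts to: a cosilting module is cotilting over R modulo its
    annihilator ([cotilting_over_annihilator]).

    Cogen T is the same class over R and over R/P.  If X is in Cogen T =
    B_zeta, extending the identity of T along T -> E splits every extension E
    of X by T, over R and so over R/P.  Conversely let X be an R/P-module with
    Ext^1_{R/P}(X, T) = 0 and let g : X -> Q1.  For x in X, the
    composite R/P -> X -> Q1 of 1 |-> x with g lifts along zeta, since R/P is in
    B_zeta.  So g takes its values in the image of zeta, and the pullback E of zeta
    along g is an extension of X by T; it is killed by P because the lifts are
    and T is.  A splitting of E over R/P is a lift of g to Q0, so X is in
    B_zeta = Cogen T. *)

(** * Factoring linear maps *)

Section Factorization.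
Variable S : pzRingType.

Lemma linear_ex (U V : lmodType S) (f : U -> V) :
  linear f -> exists g : {linear U -> V}, g =1 f.
Proof.
move=> lf; pose g : {linear U -> V} :=
  HB.pack f (GRing.isLinear.Build S U V *:%R f lf).
by exists g.
Qed.

Lemma linear_factor_mono (A B C : lmodType S) (i : {linear A -> B})
    (f : {linear C -> B}) :
  injective i -> (forall c, exists a, i a = f c) ->
  exists g : {linear C -> A}, forall c, i (g c) = f c.
Proof.
move=> inj_i /choice[g gE].
have lin_g : linear g.
  by move=> a x y; apply: inj_i; rewrite linearP !gE linearP.
by have [h hE] := linear_ex lin_g; exists h => c; rewrite hE gE.
Qed.

Lemma linear_factor_epi (A B C : lmodType S) (p : {linear A -> B})
    (f : {linear A -> C}) :
  (forall b, exists a, p a = b) -> (forall a, p a = 0 -> f a = 0) ->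
  exists g : {linear B -> C}, forall a, g (p a) = f a.
Proof.
move=> /choice[s sK] ker_le.
have fE x y : p x = p y -> f x = f y.
  move=> pxy; apply/eqP; rewrite -subr_eq0 -raddfB /=; apply/eqP.
  by apply: ker_le; rewrite raddfB /= pxy subrr.
have lin_g : linear (f \o s).
  by move=> a x y /=; rewrite -linearP; apply: fE; rewrite linearP !sK.
by have [h hE] := linear_ex lin_g; exists h => a; rewrite hE; apply: fE.
Qed.

Lemma quotmod_proj_linear (M : lmodType S) (N : submodClosed M) :
  exists p : {linear M -> quotmod N}, p =1 quotmod_proj N.
Proof.
by apply: linear_ex => a x y; rewrite quotmod_projD quotmod_projZ.
Qed.

Lemma quotmod_proj_eq0 (M : lmodType S) (N : submodClosed M) x :
  quotmod_proj N x = 0 <-> x \in N.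
Proof.
have [p pE] := quotmod_proj_linear N.
have <- : quotmod_proj N 0 = 0 by rewrite -pE raddf0.
by rewrite quotmod_projP subr0.
Qed.

Lemma quotmod_factor (M X : lmodType S) (N : submodClosed M)
    (f : {linear M -> X}) :
  {in N, forall x, f x = 0} ->
  exists g : {linear quotmod N -> X}, forall x, g (quotmod_proj N x) = f x.
Proof.
move=> fN0; have [p pE] := quotmod_proj_linear N.
have psurj q : exists x, p x = q.
  by have [x <-] := quotmod_proj_surj q; exists x.
have [x /[!pE] /quotmod_proj_eq0|g gE] := linear_factor_epi psurj (f := f).
  exact: fN0.
by exists g => x; rewrite -pE -gE.
Qed.

(** If X embeds in some product of copies of T, it embeds in the product indexed
    by Hom(X, T).  The resulting separation condition mentions maps only, so it
    is easily carried from one ring to another. *)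
Lemma CogenP (T X : lmodType S) :
  Cogen T X <->
  forall x : X, (forall f : {linear X -> T}, f x = 0) -> x = 0.
Proof.
split=> [[I [f inj_f]] x fx0|sepX].
  apply: inj_f; rewrite raddf0; apply/funext => k.
  have lin_fk : linear (fun y => f y k) by move=> a y z; rewrite linearP.
  by have [fk fkE] := linear_ex lin_fk; rewrite -fkE fx0.
have lin_ev : linear (fun (x : X) (f : {linear X -> T}) => f x).
  by move=> a x y; apply/funext => f; rewrite linearP.
have [ev evE] := linear_ex lin_ev.
exists {linear X -> T}, ev; apply: raddf_inj => x /=; rewrite evE => x0.
by apply: sepX => f; rewrite -[LHS]/((fun f : {linear X -> T} => f x) f) x0.
Qed.

End Factorization.

(** * Cosilting modules and the torsion part of the ring *)

Section Cosilting.
Variables (S : pzRingType) (T : lmodType S).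

(** Through T -> Q0 the map f extends to some F : B -> Q0 by injectivity.  The
    failure of F to take its values in T = Ker zeta is zeta F, which vanishes on
    A and so comes from a map X -> Q1; lifting that map to Q0 gives the
    correction to F that brings it back into T. *)
Lemma B_extends (Q0 Q1 : lmodType S) (zeta : {linear Q0 -> Q1})
    (i : {linear T -> Q0}) :
  injective_module Q0 -> injective i ->
  (forall y : Q0, zeta y = 0 <-> exists x, i x = y) ->
  forall (A B X : lmodType S) (j : {linear A -> B}) (p : {linear B -> X}),
  injective j -> (forall b, p b = 0 <-> exists a, j a = b) ->
  (forall x, exists b, p b = x) ->
  B_ zeta X -> forall f : {linear A -> T},
  exists g : {linear B -> T}, forall a, g (j a) = f a.
Proof.
move=> Q0inj inj_i exact_i A B X j p inj_j exact_j surj_p BX f.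
have [F FE] := Q0inj _ _ j (i \o f) inj_j.
have {}FE a : F (j a) = i (f a) by exact: FE.
have [b /exact_j[a <-]|G GE] := linear_factor_epi surj_p (f := zeta \o F).
  by rewrite /= FE; apply/exact_i; exists (f a).
have [H HE] := BX G.
have {}HE x : zeta (H x) = G x by exact: HE.
have [b|g gE] := linear_factor_mono (f := F \- (H \o p)) inj_i.
  by apply/exact_i; rewrite /= raddfB /= HE GE subrr.
exists g => a; apply: inj_i; rewrite gE /= FE.
have -> : p (j a) = 0 by apply/exact_j; exists a.
by rewrite raddf0 subr0.
Qed.

Definition annihilator : {pred S^o} := fun a =>
  `[< forall t : T, (a : S) *: t = 0 >].

Lemma annihilator_submod_closed : GRing.subsemimod_closed annihilator.
Proof.
split; first split=> [|a b /asboolP ha /asboolP hb].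
- by apply/asboolP => t; apply: scale0r.
- by apply/asboolP => t; rewrite [LHS]scalerDl ha hb addr0.
- move=> b a /asboolP ha; apply/asboolP => t.
  by rewrite -[LHS]scalerA ha scaler0.
Qed.

HB.instance Definition _ := GRing.isSubmodClosed.Build S S^o annihilator
  annihilator_submod_closed.

Lemma annihilator_mulr (a b : S) :
  a \in annihilator -> a * b \in annihilator.
Proof.
by move=> /asboolP ha; apply/asboolP => t; rewrite -[LHS]scalerA ha.
Qed.

Lemma orbit_linear (X : lmodType S) (x : X) :
  exists f : {linear S^o -> X}, forall a : S, f a = a *: x.
Proof.
by apply: linear_ex => a b c; rewrite [LHS]scalerDl -[in LHS]scalerA.
Qed.

Lemma Cogen_regular_quotient : Cogen T (quotmod annihilator).
Proof.
apply/CogenP => q; have [a <-] := quotmod_proj_surj q => fa0.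
apply/quotmod_proj_eq0/asboolP => t.
have [f fE] := orbit_linear t.
have [b /asboolP b0|g gE] := quotmod_factor (N := annihilator) (f := f).
  by rewrite fE b0.
by rewrite -fE -gE fa0.
Qed.

(** The annihilator P is torsion because a map P -> T extends to the whole ring,
    where it is multiplication by an element of T.  It is the largest torsion
    submodule because multiplication by an element of T kills every other. *)
Lemma torsion_part_regular :
  cosilting T -> torsion_part (KerHom T) S^o =i annihilator.
Proof.
move=> [Q0 [Q1 [zeta [Q0inj _ [i inj_i exact_i] cogenE]]]] a.
apply/idP/idP => [/asboolP ha|Pa].
  apply: (ha annihilator) => N Ntors b Nb; apply/asboolP => t.
  have [f fE] := orbit_linear t.
  have := Ntors (f \o (val : {linear submod N -> S^o})) (Sub b Nb).
  by rewrite /= fE.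
apply/asboolP => L tors_le; apply: (tors_le annihilator) => //.
move=> f x.
have [p pE] := quotmod_proj_linear annihilator.
have exact_p b : p b = 0 <->
    exists c, (val : {linear submod annihilator -> S^o}) c = b.
  rewrite pE quotmod_proj_eq0; split=> [Pb|[c <-]]; last exact: valP.
  by exists (Sub b Pb).
have surj_p q : exists b, p b = q.
  by have [b <-] := quotmod_proj_surj q; exists b.
have BP : B_ zeta (quotmod annihilator).
  by apply/cogenE; exact: Cogen_regular_quotient.
(* f is the restriction of some g : R -> T, and g b = (g 1) b is 0 on P. *)
have [g <-] := B_extends Q0inj inj_i exact_i val_inj exact_p surj_p BP f.
have /asboolP x0 := valP x.
by rewrite /= -[val x]mulr1 [LHS]linearZ /= x0.
Qed.

End Cosilting.

(** * Change of rings along R -> R/J *)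

Section RestrictScalars.
Variables (R : pzRingType) (J : ideal R).

Definition restrict (X : lmodType (quotring J)^c) : Type := X.

Section Module.
Variable X : lmodType (quotring J)^c.

HB.instance Definition _ := GRing.Zmodule.on (restrict X).

Definition restrict_scale (r : R^c) (x : restrict X) : restrict X :=
  (quotring_proj J r : (quotring J)^c) *: (x : X).

Lemma restrict_scaleA a b x :
  restrict_scale a (restrict_scale b x) = restrict_scale (a * b) x.
Proof.
rewrite /restrict_scale; rewrite [LHS]scalerA; congr (_ *: _).
by rewrite [a * b]/((b : R) * a) quotring_projM.
Qed.

Lemma restrict_scale1 : left_id 1 restrict_scale.
Proof. by move=> x; apply: (scale1r (x : X)). Qed.

Lemma restrict_scaleDr : right_distributive restrict_scale +%R.
Proof. by move=> a x y; apply: scalerDr. Qed.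

Lemma restrict_scaleDl x : {morph restrict_scale^~ x : a b / a + b}.
Proof.
move=> a b; rewrite /= /restrict_scale.
by rewrite [quotring_proj J _]quotring_projD; apply: scalerDl.
Qed.

HB.instance Definition _ := GRing.Zmodule_isLmodule.Build R^c (restrict X)
  restrict_scaleA restrict_scale1 restrict_scaleDr restrict_scaleDl.

End Module.

Lemma restrict_scaleE (X : lmodType (quotring J)^c) (r : R) (x : X) :
  (quotring_proj J r : (quotring J)^c) *: x =
  (r : R^c) *: (x : restrict X).
Proof. by []. Qed.

Lemma restrict_annihilated (X : lmodType (quotring J)^c) r (x : restrict X) :
  r \in J -> (r : R^c) *: x = 0.
Proof.
move=> Jr; rewrite -[LHS](@restrict_scaleE X r x).
have -> : quotring_proj J r = 0.
  have <- : quotring_proj J 0 = 0 by apply: (addIr (quotring_proj J 0));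
    rewrite -quotring_projD !add0r.
  by apply/quotring_projP; rewrite subr0.
exact: (scale0r (x : X)).
Qed.

Lemma restrict_linear (X Y : lmodType (quotring J)^c) (f : {linear X -> Y}) :
  exists g : {linear restrict X -> restrict Y}, forall x : X, g x = f x.
Proof.
by apply: (@linear_ex _ (restrict X) (restrict Y)) => r x y; exact: linearP.
Qed.

Lemma unrestrict_linear (X Y : lmodType (quotring J)^c)
    (f : {linear restrict X -> restrict Y}) :
  exists g : {linear X -> Y}, forall x : X, g x = f x.
Proof.
apply: (@linear_ex _ X Y) => q x y.
by rewrite -[q](quotring_reprK (q : quotring J)) [LHS]linearP.
Qed.

(** Restricting the R/J-structure of M to R gives M back: the identity is linear
    both ways. *)
Lemma over_quotring_linear (M : lmodType R^c) (MJ0 : annihilates J M) :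
  exists2 f : {linear M -> restrict (over_quotring MJ0)}, forall x : M, f x = x
  & exists g : {linear restrict (over_quotring MJ0) -> M},
      forall x : over_quotring MJ0, g x = x.
Proof.
have scaleE (r : R) (x : M) :
    (r : R^c) *: (x : restrict (over_quotring MJ0)) = (r : R^c) *: x.
  exact: (over_scaleE r (x : over_quotring MJ0)).
have [f fE] : exists f : {linear M -> restrict (over_quotring MJ0)}, f =1 id.
  by apply: linear_ex => r x y; rewrite scaleE.
have [g gE] : exists g : {linear restrict (over_quotring MJ0) -> M}, g =1 id.
  by apply: linear_ex => r x y; rewrite scaleE.
by exists f => //; exists g.
Qed.

Lemma Cogen_restrict (T X : lmodType (quotring J)^c) :
  Cogen T X <-> Cogen (restrict T) (restrict X).
Proof.
split=> /CogenP sepX; apply/CogenP => x fx0; apply: sepX => f.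
  by have [g gE] := restrict_linear f; rewrite -gE.
by have [g gE] := unrestrict_linear f; rewrite -gE.
Qed.

End RestrictScalars.

(** * Cosilting modules are cotilting over the ring modulo their annihilator *)

Section Cotilting.
Variables (R : pzRingType) (J : ideal R) (T : lmodType (quotring J)^c).
Variables (Q0 Q1 : lmodType R^c) (zeta : {linear Q0 -> Q1}).
Hypothesis Q0inj : injective_module Q0.
Variable i : {linear restrict T -> Q0}.
Hypothesis inj_i : injective i.
Hypothesis exact_i : forall y : Q0, zeta y = 0 <-> exists x, i x = y.

(** A map E -> T that extends the identity of T splits the extension E. *)
Lemma B_Ext1_zero (X : lmodType (quotring J)^c) :
  B_ zeta (restrict X) -> Ext1_zero X T.
Proof.
move=> BX E.
have [j jE] := restrict_linear (ext_in E).
have [p pE] := restrict_linear (ext_out E).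
have inj_j : injective j by move=> x y; rewrite !jE; exact: ext_in_inj.
have exact_j b : p b = 0 <-> exists a, j a = b.
  rewrite pE; split=> [x0|[a <-]].
    by have [a aE] := (@ext_exact _ _ _ E b).1 x0; exists a; rewrite jE.
  by rewrite jE; apply: (@ext_exact _ _ _ E _).2; exists a.
have surj_p x : exists b, p b = x.
  by have [b bE] := ext_out_surj E x; exists b; rewrite pE.
have [g gE] := B_extends Q0inj inj_i exact_i inj_j exact_j surj_p BX
  (idfun : {linear restrict T -> restrict T}).
have [r rE] := unrestrict_linear g.
have [phi phiE] : exists phi : {linear ext_mid E -> (T * X)%type},
    forall e, phi e = (r e, ext_out E e).
  by apply: linear_ex => a x y; rewrite !linearP.
exists phi; split=> [t|e] /=; rewrite phiE //.
congr (_, _); last by apply: (@ext_exact _ _ _ E _).2; exists t.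
by rewrite rE -jE gE.
Qed.

(** The pullback of zeta along a map X -> Q1 is the extension of X by T that
    measures whether the map lifts to Q0.  The lifts through R/J do double
    duty: they make the pullback surject onto X, and, as their values are killed
    by J, they make it a module over R/J. *)
Lemma Ext1_zero_B (X : lmodType (quotring J)^c) :
  B_ zeta (quotmod (annihilator (restrict T))) ->
  {subset annihilator (restrict T) <= J} ->
  Ext1_zero X T -> B_ zeta (restrict X).
Proof.
set P := annihilator _ => BP sPJ ExtX g.
(* The map R -> X, r |-> x r factors through R/P because J kills X, and R/P lies
   in B_zeta; so the image of 1 in Q0 is a lift of g x killed by J. *)
have lift x : exists2 q : Q0, zeta q = g x &
    forall r, r \in J -> (r : R^c) *: q = 0.
  have [f fE] := orbit_linear x.
  have [a /sPJ Ja|h hE] := quotmod_factor (N := P) (f := g \o f).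
    by rewrite /= fE restrict_annihilated // raddf0.
  have [k kE] := BP h.
  exists (k (quotmod_proj P 1)).
    by rewrite [LHS]kE hE /= fE scale1r.
  move=> r Jr; rewrite -linearZ /=.
  have -> : (r : R^c) *: quotmod_proj P 1 = 0.
    rewrite -[LHS]quotmod_projZ; apply/quotmod_proj_eq0/asboolP => t.
    by rewrite -[LHS]scalerA scale1r restrict_annihilated.
  exact: raddf0.
(* The pullback of zeta and g, as the kernel of their difference. *)
have [d dE] : exists d : {linear (Q0 * restrict X)%type -> Q1},
    forall e, d e = zeta e.1 - g e.2.
  by exists ((zeta \o fst) \- (g \o snd)).
pose E := kermod d.
have E_J : annihilates J E.
  move=> r Jr [[q x] /= e0]; apply: val_inj => /=.
  move: e0; rewrite inE dE subr_eq0 /= => /eqP qx.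
  have [q' q'x q'J] := lift x.
  (* q and q' have the same image under zeta, so they differ by an element of
     T; both q' and T are killed by J. *)
  have [t tE] : exists t, i t = q - q'.
    by apply/exact_i; rewrite raddfB /= qx q'x subrr.
  congr (_, _) => /=; last exact: restrict_annihilated.
  rewrite -[q](subrK q') -tE scalerDr q'J // addr0 -linearZ /=.
  by rewrite restrict_annihilated // raddf0.
have [toE toEE [ofE ofEE]] := over_quotring_linear E_J.
have [v vE] : exists v : {linear E -> (Q0 * restrict X)%type}, v =1 val.
  by exists val.
have inj_v : injective v by move=> e e'; rewrite !vE; exact: val_inj.
have vP e : zeta (v e).1 = g (v e).2.
  by have := valP e; rewrite -vE inE dE subr_eq0 => /eqP.
have [i0 i0E] : exists i0 : {linear restrict T -> (Q0 * restrict X)%type},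
    forall t, i0 t = (i t, 0).
  by apply: linear_ex => a x y; rewrite linearP; congr (_, _);
    rewrite /= scaler0 addr0.
have [t|j jE] := linear_factor_mono (f := i0) inj_v.
  have t0 : i0 t \in ker d.
    by rewrite inE dE i0E raddf0 subr0; apply/eqP/exact_i; exists t.
  by exists (Sub (i0 t) t0); rewrite vE.
have [j' j'E] := unrestrict_linear (toE \o j).
have [p pE] := unrestrict_linear (snd \o (v \o ofE)).
have inj_j' : injective j'.
  move=> s t; rewrite !j'E /= !toEE => /(congr1 v).
  by rewrite !jE !i0E => -[/inj_i].
have exact_j' e : p e = 0 <-> exists t, j' t = e.
  rewrite pE /= ofEE; split=> [x0|[t <-]]; last by rewrite j'E /= toEE jE i0E.
  have [t tE] : exists t, i t = (v e).1.
    by apply/exact_i; rewrite vP x0 raddf0.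
  exists t; rewrite j'E /= toEE; apply: inj_v.
  by rewrite jE i0E tE -x0 -surjective_pairing.
have surj_p x : exists e, p e = x.
  have [q qx _] := lift x.
  have qx0 : (q, x) \in ker d by rewrite inE dE /= qx subrr.
  by exists (Sub (q, x) qx0 : E); rewrite pE /= ofEE vE.
have [phi [phi_j _]] := ExtX (Extension inj_j' exact_j' surj_p).
have [rho rhoE] := restrict_linear (fst \o phi).
have surj_v2 (x : restrict X) : exists e, (snd \o v) e = x.
  by have [e eE] := surj_p x; exists e; rewrite -eE pE /= ofEE.
(* Correcting the projection E -> Q0 by the retraction rho makes it vanish on T;
   what it induces on X is the lift of g. *)
have [e /= e0|h hE] := linear_factor_epi (p := snd \o v)
  (f := (fst \o v) \- (i \o (rho \o toE))) surj_v2.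
  have /exact_j'[t tE] : p e = 0 by rewrite pE /= ofEE.
  rewrite /= toEE -tE rhoE /= [phi _]phi_j /= j'E /= toEE.
  by rewrite jE i0E subrr.
exists h => x /=; have [e <-] := surj_v2 x.
rewrite hE /= raddfB /= vP.
have -> : zeta (i (rho (toE e))) = 0 by apply/exact_i; exists (rho (toE e)).
exact: subr0.
Qed.

End Cotilting.

(** The two conditions on J say that it is the annihilator of T, i.e. that T is
    a faithful R/J-module. *)
Theorem cotilting_over_annihilator (R : pzRingType) (J : ideal R)
    (T : lmodType R^c) (TJ0 : annihilates J T) :
  {subset annihilator T <= J} -> cosilting T -> cotilting (over_quotring TJ0).
Proof.
move=> sPJ [Q0 [Q1 [zeta [Q0inj _ [i inj_i exact_i] cogenE]]]] X.
have [toT toTE [ofT ofTE]] := over_quotring_linear TJ0.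
set T' := over_quotring TJ0.
have cogenT' (Y : lmodType R^c) : Cogen (restrict T') Y <-> B_ zeta Y.
  rewrite -cogenE; split=> /CogenP sepY; apply/CogenP => y fy0;
    apply: sepY => f.
    by have /= := fy0 (ofT \o f); rewrite ofTE.
  by have /= := fy0 (toT \o f); rewrite toTE.
have inj_i' : injective (i \o ofT).
  by move=> s t /= /inj_i; rewrite !ofTE.
have exact_i' y : zeta y = 0 <-> exists x, (i \o ofT) x = y.
  by rewrite exact_i; split=> -[t <-]; exists t; rewrite /= ofTE.
have sPJ' : {subset annihilator (restrict T') <= J}.
  move=> r /asboolP r0; apply: sPJ; apply/asboolP => t.
  by rewrite -[LHS]toTE linearZ /= r0.
rewrite Cogen_restrict cogenT'; split.
  exact: B_Ext1_zero inj_i' exact_i' _.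
apply: Ext1_zero_B inj_i' exact_i' _ _ _ => //.
by apply/cogenT'; exact: Cogen_regular_quotient.
Qed.

Theorem corollary3p9 (R : pzRingType) (Q0 Q1 : lmodType R^c)
  (zeta : {linear Q0 -> Q1})
  (Q0_inj : injective_module Q0) (Q1_inj : injective_module Q1) :
  let T : lmodType R^c := kermod zeta in
  let I : submodClosed (R^c)^o := torsion_part (KerHom T) (R^c)^o in
  let RI : lmodType R^c := quotmod I in
  let J : ideal R := ann RI in
  cosilting T ->
  (commutative (@GRing.mul R) \/ fin_gen_over_End RI) ->
  exists TJ0 : annihilates J T, cotilting (over_quotring TJ0).
Proof.
move=> T I RI J cosT _.
have IE := torsion_part_regular cosT.
(* I is the annihilator of T, hence a two-sided ideal, so I = ann (R/I). *)
have JP r : r \in J <-> r \in annihilator T.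
  split=> [/asboolP r0|Pr].
    have := r0 (quotmod_proj I 1); rewrite -[X in X = _ -> _]quotmod_projZ.
    by move/quotmod_proj_eq0; rewrite [_ *: _]mulr1 IE.
  apply/asboolP => q; have [a <-] := quotmod_proj_surj q.
  rewrite -[LHS]quotmod_projZ; apply/quotmod_proj_eq0; rewrite IE.
  exact: annihilator_mulr.
have TJ0 : annihilates J T by move=> r /JP/asboolP r0 t.
by exists TJ0; apply: cotilting_over_annihilator => // r /JP.
Qed.
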